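(* $\mathscr{SZ}_0=\mathscr K$; that is, an operator $T$ between Banach spaces satisfies $\mathrm{Sz}(T)\leqslant\omega^0=1$ if and only if $T$ is compact.
   Context: Banach spaces are over $\mathbb K\in\{\mathbb R,\mathbb C\}$; an operator is a bounded linear map between Banach spaces; $B_E$ is the closed unit ball of $E$; $T^*$ is the adjoint of $T$; $\mathscr K$ is the class of compact operators. Szlenk index. Let $E$ be a Banach space, $K\subseteq E^*$ a $w^*$-compact set and $\varepsilon>0$. Put $s_\varepsilon(K)=\{x\in K : \operatorname{diam}(K\cap V)>\varepsilon \text{ for every } w^*\text{-open } V\ni x\}$ (norm diameter), $s^0_\varepsilon(K)=K$, $s^{\alpha+1}_\varepsilon(K)=s_\varepsilon(s^\alpha_\varepsilon(K))$, and $s^\alpha_\varepsilon(K)=\bigcap_{\beta<\alpha}s^\beta_\varepsilon(K)$ for limit ordinals $\alpha$. $\mathrm{Sz}_\varepsilon(K)$ is the class of all ordinals $\alpha$ with $s^\alpha_\varepsilon(K)\neq\emptyset$; that is, the least ordinal $\alpha$ with $s^\alpha_\varepsilon(K)=\emptyset$ if one exists, and otherwise the class of all ordinals, written $\infty$. $\mathrm{Sz}(K)=\bigcup_{\varepsilon>0}\mathrm{Sz}_\varepsilon(K)=\sup_{\varepsilon>0}\mathrm{Sz}_\varepsilon(K)$. For an operator $T:E\to F$, $\mathrm{Sz}(T)=\mathrm{Sz}(T^*B_{F^*})$. $\mathscr{SZ}_\alpha$ is the class of all operators $T$ with $\mathrm{Sz}(T)\leqslant\omega^\alpha$. *)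

(* Defs.v *)
Set Warnings "-notation-overridden,-ambiguous-paths,-notation-incompatible-prefix".
From HB Require Import structures.
From mathcomp Require Import all_boot all_order all_algebra.
From mathcomp Require Import complex.
From mathcomp Require Import all_classical all_reals.
From mathcomp Require Import ereal topology normedtype.

Set Implicit Arguments.
Unset Strict Implicit.
Unset Printing Implicit Defensive.

Import Order.TTheory GRing.Theory Num.Theory.
Import numFieldNormedType.Exports.

Local Open Scope classical_set_scope.
Local Open Scope ring_scope.

(** Ordinals are presented by well-founded trees built from zero, successors
    and suprema of nonempty small families.  The order [ole] is a preorder:
    two trees denote the same ordinal when each is [ole] the other.
    Predicates on ordinals are written [ord -> Prop], not [set ord], so that
    families may be indexed by types as large as [set T]. *)

Inductive ord : Type :=
| OZero : ord
| OSucc : ord -> ord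
| OSup (I : Type) : inhabited I -> (I -> ord) -> ord.

(* The inner fixpoint is the strict order: [a.+1 <= b] means [a < b]. *)
Fixpoint ole (a : ord) : ord -> Prop :=
  match a with
  | OZero => fun=> True
  | OSucc a' =>
      fix lt (b : ord) : Prop :=
        match b with
        | OZero => False
        | OSucc b' => ole a' b'
        | OSup _ _ g => exists j, lt (g j)
        end
  | OSup _ _ f => fun b => forall i, ole (f i) b
  end.

Definition olt (a b : ord) : Prop := ole (OSucc a) b.

Fixpoint oadd (a b : ord) : ord :=
  match b with
  | OZero => a
  | OSucc b' => OSucc (oadd a b')
  | OSup _ h f => OSup h (fun i => oadd a (f i))
  end.

Fixpoint omul (a b : ord) : ord :=
  match b with
  | OZero => OZero
  | OSucc b' => oadd (omul a b') a
  | OSup _ h f => OSup h (fun i => omul a (f i))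
  end.

(* The supremum clause is the usual one for nonzero bases only. *)
Fixpoint opow (a b : ord) : ord :=
  match b with
  | OZero => OSucc OZero
  | OSucc b' => omul (opow a b') a
  | OSup _ h f => OSup h (fun i => opow a (f i))
  end.

Definition omega : ord := OSup (inhabits 0%N) (fun n => iter n OSucc OZero).

Lemma ole_sup a I (h : inhabited I) (f : I -> ord) i :
  ole a (f i) -> ole a (OSup h f).
Proof.
elim: a => [//|a _|J hJ g IH] /= H; first by exists i.
by move=> j; apply: IH.
Qed.

Lemma ole_refl a : ole a a.
Proof. by elim: a => [//|//|I h f IH] i; apply: ole_sup (IH i). Qed.

Lemma ole_trans a b c : ole a b -> ole b c -> ole a c.
Proof.
elim: a b c => [//|a IHa|I h f IH] b c; last first.
  by move=> H bc i; apply: IH (H i) bc.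
elim: b c => [//|b _|J hJ g IHb] c /=.
- move=> ab; elim: c => [//|c _|L hL k IHc] /=; first exact: IHa.
  by case=> l /IHc ?; exists l.
- by case=> j aj H; apply: IHb aj (H j).
Qed.

Lemma ole_succ a : ole a (OSucc a).
Proof.
elim: a => [//|//|I h f IH] i; apply: ole_trans (IH i) _.
exact: (@ole_sup (f i) _ h f i (ole_refl _)).
Qed.

Lemma oltW a b : olt a b -> ole a b.
Proof. exact/ole_trans/ole_succ. Qed.

Lemma ole_total a b : ole a b \/ olt b a.
Proof.
elim: a b => [|a IHa|I h f IH] b; first by left.
- elim: b => [|b _|J hJ g IHb]; first by right.
    exact: IHa.
  have [[j aj]|H] := pselect (exists j, ole (OSucc a) (g j)).
    by left; exists j.
  by right => j; have [aj|//] := IHb j; case: H; exists j.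
- have [[i ai]|H] := pselect (exists i, olt b (f i)); first by right; exists i.
  by left => i; have [//|bi] := IH i b; case: H; exists i.
Qed.

Lemma olt_wf : well_founded olt.
Proof.
suff H a : forall b, ole b a -> Acc olt b by move=> a; apply: (H a) (ole_refl a).
elim: a => [|a IHa|I h f IH] b ba; constructor => c cb.
- by have := ole_trans cb ba.
- exact/IHa/(ole_trans cb ba).
- by have [i ci] := ole_trans cb ba; apply: (IH i); exact: oltW.
Qed.

(** The scalar field: the reals or the complex numbers over a given model [R]
    of the reals.  MathComp-Analysis norms take values in the scalar field, so
    [toR] is used to read them (they are nonnegative) in [R]. *)

Variant scalar_kind := RealScalars | ComplexScalars.

Definition scalar_field (R : realType) (k : scalar_kind) : numFieldType :=
  match k with
  | RealScalars => R
  | ComplexScalars => (R[i])%C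
  end.

Definition toR (R : realType) (k : scalar_kind) : scalar_field R k -> R :=
  match k with
  | RealScalars => id
  | ComplexScalars => @complex.Re R
  end.

Definition unit_ball (K : numFieldType) (E : normedModType K) : set E :=
  [set x | `|x| <= 1].

Record operator (K : numFieldType) (E F : normedModType K) := Operator {
  opfun :> {linear E -> F};
  op_bounded : bounded_near opfun (nbhs (0 : E)) }.

Lemma op_continuous (K : numFieldType) (E F : normedModType K)
  (T : operator E F) : continuous T.
Proof. exact/linear_bounded_continuous/op_bounded. Qed.

Definition compact_operator (K : numFieldType) (E F : normedModType K)
  (T : operator E F) : Prop := precompact (T @` @unit_ball K E).

Definition dual (K : numFieldType) (E : normedModType K) : Type :=
  operator E (K^o : normedModType K).

HB.instance Definition _ (K : numFieldType) (E F : normedModType K) :=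
  gen_eqMixin (operator E F).
HB.instance Definition _ (K : numFieldType) (E F : normedModType K) :=
  gen_choiceMixin (operator E F).

Definition dual_eval (K : numFieldType) (E : normedModType K) (f : dual E) :
  {ptws E -> K^o} := fun x => f x.

Definition weak_star (K : numFieldType) (E : normedModType K) :
  topologicalType := initial_topology (@dual_eval K E).

Lemma adjoint_bounded (K : numFieldType) (E F : normedModType K)
    (T : operator E F) (f : dual F) :
  bounded_near (f \o T : {linear E -> K^o}) (nbhs (0 : E)).
Proof.
apply/linear_bounded_continuous => x.
by apply: continuous_comp; exact: op_continuous.
Qed.

Definition adjoint (K : numFieldType) (E F : normedModType K)
  (T : operator E F) (f : dual F) : dual E := Operator (adjoint_bounded T f).

Section Szlenk.
Variables (R : realType) (k : scalar_kind).
Local Notation K := (scalar_field R k).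

Definition rnorm (E : normedModType K) (x : E) : R := toR `|x|.

(* Meant for linear [u]; values in the extended reals so that the supremum
   needs no boundedness proof. *)
Definition opnorm (E F : normedModType K) (u : E -> F) : \bar R :=
  ereal_sup [set (rnorm (u x))%:E | x in @unit_ball K E].

Section Dual.
Variable E : normedModType K.

Definition dual_ball : set (dual E) := [set f | (opnorm f <= 1%:E)%E].

Definition diam (A : set (dual E)) : \bar R :=
  ereal_sup [set opnorm (f \- g) | f in A & g in A].

Definition szlenk_step (eps : R) (A : set (dual E)) : set (dual E) :=
  [set f | A f /\
    forall V : set (weak_star E), open V -> V f ->
      (eps%:E < diam (A `&` V))%E].

Fixpoint szlenk_deriv (eps : R) (A : set (dual E)) (a : ord) : set (dual E) :=
  match a with
  | OZero => A
  | OSucc b => szlenk_step eps (szlenk_deriv eps A b)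
  | OSup _ _ f => [set x | forall i, szlenk_deriv eps A (f i) x]
  end.

(* As in the von Neumann convention, an index is the class of the ordinals
   below it; the class of all ordinals plays the role of infinity. *)
Definition Sz_eps (eps : R) (A : set (dual E)) : ord -> Prop :=
  fun a => szlenk_deriv eps A a !=set0.

Definition Sz (A : set (dual E)) : ord -> Prop :=
  fun a => exists2 eps : R, 0 < eps & Sz_eps eps A a.

Lemma szlenk_step_mono eps A B :
  A `<=` B -> szlenk_step eps A `<=` szlenk_step eps B.
Proof.
move=> AB f [Af H]; split; first exact: AB.
move=> V oV Vf; apply: lt_le_trans (H V oV Vf) _; apply: ereal_sup_le.
by apply: image2_subset; exact: setSI.
Qed.

Lemma szlenk_deriv_decr eps A a b :
  ole a b -> szlenk_deriv eps A b `<=` szlenk_deriv eps A a.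
Proof.
elim: a b => [|a IHa|I h f IH] b /=.
- move=> _; elim: b => [|b IHb|J [j] g IHb] x //=.
    by case=> + _; exact: IHb.
  by move=> /(_ j); exact: IHb.
- elim: b => [//|b _|J hJ g IHb] /=; first by move=> /IHa; exact: szlenk_step_mono.
  by case=> j /IHb H x /(_ j); exact: H.
- by move=> H x bx i; apply: IH (H i) _ bx.
Qed.

Lemma szlenk_deriv_limit eps A a :
  olt OZero a -> (forall b, olt b a -> olt (OSucc b) a) ->
  szlenk_deriv eps A a = [set x | forall b, olt b a -> szlenk_deriv eps A b x].
Proof.
move=> a0 alim; apply/seteqP; split=> x /=.
  by move=> ax b /oltW /szlenk_deriv_decr; apply.
move=> H.
have {}H b : olt b a -> szlenk_step eps (szlenk_deriv eps A b) x.
  by move=> /alim /H.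
have Ax : A x by have [] := H _ a0.
move: H; clear a0 alim; elim: a => [//|a _|I h f IH] H /=.
  by apply: H; exact: ole_refl.
by move=> i; apply: IH => b bi; apply: H; exists i.
Qed.

(* The derivation always becomes stationary, so nothing is lost by
   considering only the ordinals in [ord]. *)
Lemma szlenk_deriv_stationary eps A :
  exists a, szlenk_deriv eps A (OSucc a) = szlenk_deriv eps A a.
Proof.
apply: contrapT => nst.
pose D := szlenk_deriv eps A.
have lt_proper a b : olt a b -> D b <> D a.
  move=> ab Dab; apply: nst; exists a; apply/seteqP; split.
    by move=> x [].
  by rewrite -/(D a) -Dab; exact: szlenk_deriv_decr ab.
pose P X a := D a = X.
pose idx X := if pselect (exists a, P X a) is left e then projT1 (cid e) else OZero.
have idxP a : ole a (idx (D a)).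
  rewrite /idx; case: pselect => [e|]; last by case; exists a.
  case: (cid e) => b Db /=; have [//|/lt_proper] := ole_total a b.
  by rewrite Db.
pose top := OSup (inhabits (D OZero)) (fun X => OSucc (idx X)).
have ltt : olt top top.
  apply: (@ole_trans _ (OSucc (idx (D top)))); first exact (idxP top).
  by exists (D top); exact: ole_refl.
by elim: (olt_wf top) ltt => b _ IH bb; exact: (IH b).
Qed.

End Dual.

Definition Sz_op (E F : normedModType K) (T : operator E F) : ord -> Prop :=
  Sz (adjoint T @` @dual_ball F).

Definition SZ (alpha : ord) (E F : normedModType K) (T : operator E F) : Prop :=
  forall b, Sz_op T b -> olt b (opow omega alpha).

End Szlenk.

(* Main.v *)
(* Sz(T) <= 1 means that A = T^* B_{F^*} has empty derivation for each eps, that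
   is, each point of A has a weak-star neighbourhood meeting A in a set of
   diameter at most eps.  If closure (T B_E) is compact, functionals of A that are
   close weak-star are close in norm.  Conversely, if A has small weak-star
   slices, weak-star compactness of B_{F^*} (Banach-Alaoglu) makes every
   ultrafilter on closure (T B_E) Cauchy uniformly against B_{F^*}, hence Cauchy
   in norm by Hahn-Banach.  Hahn-Banach itself comes from a minimal sublinear
   functional, which is necessarily linear. *)

Set Warnings "-notation-overridden,-ambiguous-paths,-notation-incompatible-prefix,-redundant-canonical-projection".
Require Import Defs.
From HB Require Import structures.
From mathcomp Require Import all_boot all_order all_algebra.
From mathcomp Require Import complex lra.
From mathcomp Require Import all_classical all_reals.
From mathcomp Require Import ereal topology normedtype.

Set Implicit Arguments.
Unset Strict Implicit.
Unset Printing Implicit Defensive.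

Import Order.TTheory GRing.Theory Num.Theory.
Import numFieldNormedType.Exports.

Local Open Scope classical_set_scope.
Local Open Scope ring_scope.

(** * Hahn-Banach for sublinear functionals on real vector spaces *)

Section HahnBanach.
Variables (R : realType) (V : lmodType R).
Implicit Types (p q : V -> R) (x y : V).

(** Homogeneity is only an inequality, which is easy to check for infima; scaling back by [t^-1]
    recovers equality for positive [t]. *)
Definition sublinear q :=
  (forall x y, q (x + y) <= q x + q y) /\
  (forall (t : R) x, 0 <= t -> q (t *: x) <= t * q x).

Lemma sublinear0 q : sublinear q -> q 0 = 0.
Proof.
move=> [qD qZ]; have := qZ 0 0 (lexx _); have := qD 0 0.
by rewrite scale0r addr0 mul0r; lra.
Qed.

Lemma sublinearZ q t x : sublinear q -> 0 <= t -> q (t *: x) = t * q x.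
Proof.
move=> sq; have [_ qZ] := sq; rewrite le_eqVlt => /predU1P[<-|t0].
  by rewrite scale0r mul0r sublinear0.
apply/eqP; rewrite eq_le qZ ?(ltW t0)//=.
have := qZ t^-1 (t *: x).
rewrite scalerA mulVf ?gt_eqF// scale1r invr_ge0 (ltW t0).
by move=> /(_ isT); rewrite ler_pdivlMl.
Qed.

Lemma sublinearN q x : sublinear q -> - q (- x) <= q x.
Proof.
by move=> sq; have := sq.1 x (- x); rewrite subrr sublinear0//; lra.
Qed.

(** The index [l] may depend on the points, so the criterion covers both a chain (take the smaller
    functional) and the family behind [tilt] (add or rescale the parameters). *)
Lemma inf_sublinear (I : Type) (D : set I) (q : I -> V -> R) :
  D !=set0 -> (forall x, has_lbound [set q i x | i in D]) ->
  (forall i j x y, D i -> D j ->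
     exists2 l, D l & q l (x + y) <= q i x + q j y) ->
  (forall i t x, D i -> 0 <= t -> exists2 l, D l & q l (t *: x) <= t * q i x) ->
  sublinear (fun x => inf [set q i x | i in D]).
Proof.
move=> [i0 Di0] lbq qD qZ.
have infP i x : D i -> inf [set q i x | i in D] <= q i x.
  by move=> Di; apply: ge_inf => //; exists i.
have lowerP c x : (forall i, D i -> c <= q i x) ->
    c <= inf [set q i x | i in D].
  move=> H; apply: lb_le_inf; first by exists (q i0 x), i0.
  by move=> _ [i Di <-]; exact: H.
split=> [x y|t x t0].
  rewrite -lerBlDr; apply: (lowerP) => i Di.
  rewrite lerBlDr -lerBlDl; apply: (lowerP) => j Dj; rewrite lerBlDl.
  have [l Dl] := qD i j x y Di Dj; apply: le_trans; exact: (infP).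
have [l Dl] := qZ i0 t x Di0 t0.
move: t0; rewrite le_eqVlt => /predU1P[<-|t0].
  by rewrite !mul0r; apply: le_trans; exact: (infP).
move=> _; rewrite -ler_pdivrMl//; apply: (lowerP) => i Di.
have {l Dl}[l Dl] := qZ i t x Di (ltW t0); rewrite ler_pdivrMl//.
by apply: le_trans; exact: (infP).
Qed.

(** For sublinear [q], this is the greatest sublinear functional below [q] whose value at [- y] is
    at most [- q y]. *)
Definition tilt q y x :=
  inf [set q (x + t *: y) - t * q y | t in [set t : R | 0 <= t]].

(** Subadditivity at [x + t *: y] and [- x] gives a bound free of [t], so the infimum in [tilt] is
    finite. *)
Lemma tilt_lb q x y : sublinear q ->
  lbound [set q (x + t *: y) - t * q y | t in [set t : R | 0 <= t]] (- q (- x)).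
Proof.
move=> sq _ [t /= t0 <-]; have := sq.1 (x + t *: y) (- x).
by rewrite addrAC subrr add0r sublinearZ//; lra.
Qed.

Lemma tilt_le q x y t : sublinear q -> 0 <= t ->
  tilt q y x <= q (x + t *: y) - t * q y.
Proof.
move=> sq t0; apply: ge_inf; last by exists t.
by exists (- q (- x)); exact: tilt_lb.
Qed.

Lemma tilt_sublinear q y : sublinear q -> sublinear (tilt q y).
Proof.
move=> sq; apply: (@inf_sublinear R [set t | 0 <= t]
  (fun t x => q (x + t *: y) - t * q y)).
- by exists 0 => /=.
- by move=> x; exists (- q (- x)); exact: tilt_lb.
- move=> s t x z /= s0 t0; exists (s + t); first exact: addr_ge0.
  by rewrite scalerDl addrACA; have := sq.1 (x + s *: y) (z + t *: y); lra.
- move=> s t x /= s0 t0; exists (t * s); first exact: mulr_ge0.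
  by rewrite -scalerA -scalerDr sublinearZ// mulrBr mulrA.
Qed.

Definition minorant p := {q : V -> R | sublinear q /\ forall x, q x <= p x}.

(** Zorn's lemma for the reversed pointwise order. A nonempty chain is bounded by its pointwise
    infimum, which is finite because every sublinear [u] below [p] satisfies [- p (- x) <= u x]. *)
Lemma minimal_sublinear p : sublinear p -> exists q, [/\ sublinear q,
  forall x, q x <= p x &
  forall q', sublinear q' -> (forall x, q' x <= q x) -> forall x, q x <= q' x].
Proof.
move=> sp; have p0 : sublinear p /\ forall x, p x <= p x by [].
pose r (u v : minorant p) := `[< forall x, sval v x <= sval u x >].
have [|||[q [sq qp]] qmin] := @ZL_preorder (minorant p) (exist _ p p0) r.
- by move=> u; apply/asboolP.
- move=> u v w /asboolP uv /asboolP vw; apply/asboolP => x.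
  exact: le_trans (vw x) (uv x).
- move=> C Ctot; have [->|C0] := eqVneq C set0; first by exists (exist _ p p0).
  have {C0} [u0 Cu0] := (set0P _).1 C0.
  have lbC x : lbound [set sval u x | u in C] (- p (- x)).
    move=> _ [[u [su up]] /= Cu <-].
    by apply: le_trans (sublinearN x su); rewrite lerN2.
  have sC : sublinear (fun x => inf [set sval u x | u in C]).
    apply: (@inf_sublinear _ C (fun u => sval u)) => //.
    + by exists u0.
    + by move=> x; exists (- p (- x)).
    + move=> u v x y Cu Cv; have [su _] := svalP u; have [sv _] := svalP v.
      have [/asboolP uv|/asboolP vu] := Ctot u v Cu Cv.
      * exists v => //; apply: le_trans (sv.1 x y) _; exact: lerD.
      * exists u => //; apply: le_trans (su.1 x y) _; exact: lerD.
    + by move=> u t x Cu t0; exists u => //; apply: (svalP u).1.2.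
  have infle u x : C u -> inf [set sval u x | u in C] <= sval u x.
    by move=> Cu; apply: ge_inf; [exists (- p (- x)) | exists u].
  have Cp x : inf [set sval u x | u in C] <= p x.
    by apply: le_trans (infle u0 x Cu0) _; exact: (svalP u0).2.
  pose i x := inf [set sval u x | u in C].
  have ip : sublinear i /\ forall x, i x <= p x by [].
  exists (exist _ i ip) => u Cu; apply/asboolP => x; exact: infle.
exists q; split=> // q' sq' q'q.
have q'p x : q' x <= p x by apply: le_trans (qp x).
have q'ok : sublinear q' /\ forall x, q' x <= p x by [].
by apply/asboolP; apply: (qmin (exist _ q' q'ok)); apply/asboolP.
Qed.

(* A minimal sublinear functional lies below each of its tilts, which makes it
   additive. *)
Lemma sublinear_minorant p : sublinear p ->
  exists2 f : V -> R, scalar f & forall x, f x <= p x.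
Proof.
move=> /minimal_sublinear[q [sq qp qmin]]; exists q => //.
have qD x y : q (x + y) = q x + q y.
  apply/eqP; rewrite eq_le sq.1 /=.
  (* Parameter [1] puts the tilt below [q (x + y) - q y]; parameter [0], used next, puts it below
     [q], so that minimality applies. *)
  have t1 := @tilt_le q x y 1 sq ler01; rewrite scale1r mul1r in t1.
  rewrite -lerBrDr; apply: le_trans t1.
  apply: qmin (tilt_sublinear y sq) _ x => z.
  by have := @tilt_le q z y 0 sq (lexx _); rewrite scale0r addr0 mul0r subr0.
have qN x : q (- x) = - q x.
  by apply/eqP; rewrite -addr_eq0 -qD addNr sublinear0.
move=> t x y; rewrite qD; congr (_ + _).
have [t0|/ltW t0] := leP 0 t; first exact: sublinearZ.
by rewrite -[t]opprK scaleNr qN sublinearZ ?oppr_ge0// -mulNr.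
Qed.

(* Below [tilt p y], a linear functional [f] satisfies [f (- y) <= - p y]. *)
Theorem hahn_banach_sublinear p y : sublinear p ->
  exists2 f : {scalar V}, forall x, f x <= p x & f y = p y.
Proof.
move=> sp; have [g lg gp] := sublinear_minorant (tilt_sublinear y sp).
pose f : {scalar V} := HB.pack g (GRing.isLinear.Build R V R *%R g lg).
have {}gp x : f x <= tilt p y x by exact: gp.
have fp x : f x <= p x.
  apply: le_trans (gp x) _; have := @tilt_le p x y 0 sp (lexx _).
  by rewrite scale0r addr0 mul0r subr0.
exists f => //; apply/eqP; rewrite eq_le fp/=.
have := le_trans (gp (- y)) (@tilt_le p (- y) y 1 sp ler01).
by rewrite scale1r mul1r addNr sublinear0// add0r linearN lerN2.
Qed.

End HahnBanach.

(** * Norms read in [R], over either scalar field *)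

Section ScalarNorm.
Variables (R : realType) (k : scalar_kind).
Local Notation K := (scalar_field R k).

Definition ofR : R -> K :=
  match k with RealScalars => id | ComplexScalars => fun r => r%:C%C end.

Lemma toRK r : toR (ofR r) = r.
Proof. by rewrite /ofR /toR; case: k. Qed.

Lemma ofRD a b : ofR (a + b) = ofR a + ofR b.
Proof. by rewrite /ofR; case: k => //=; rewrite rmorphD. Qed.

Lemma ofRM a b : ofR (a * b) = ofR a * ofR b.
Proof. by rewrite /ofR; case: k => //=; rewrite rmorphM. Qed.

Lemma ofR1 : ofR 1 = 1.
Proof. by rewrite /ofR; case: k. Qed.

Lemma ler_ofR a b : (ofR a <= ofR b) = (a <= b).
Proof. by rewrite /ofR; case: k => //=; rewrite lecR. Qed.

Lemma ltr_ofR a b : (ofR a < ofR b) = (a < b).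
Proof. by rewrite /ofR; case: k => //=; rewrite ltcR. Qed.

Lemma ofR_gt0 a : (0 < ofR a) = (0 < a).
Proof. by rewrite -ltr_ofR /ofR; case: k. Qed.

(** A complex number comparable with [0] is real, so positive radii lose nothing when read in
    [R]. *)
Lemma gt0_ofR (e : K) : 0 < e -> e = ofR (toR e).
Proof.
rewrite /ofR /toR; case: k e => //= e e0.
by rewrite RRe_real// gtr0_real.
Qed.

Implicit Type E : normedModType K.

Lemma norm_ofR E (x : E) : `|x| = ofR (rnorm x).
Proof.
rewrite /ofR /rnorm /toR; case: k E x => //= F x.
by rewrite RRe_real// normr_real.
Qed.

Lemma rnorm_ge0 E (x : E) : 0 <= rnorm x.
Proof.
rewrite -ler_ofR -norm_ofR; apply: le_trans (normr_ge0 x).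
by rewrite /ofR; case: k.
Qed.

Lemma rnormD E (x y : E) : rnorm (x + y) <= rnorm x + rnorm y.
Proof. by rewrite -ler_ofR ofRD -!norm_ofR ler_normD. Qed.

Lemma rnormN E (x : E) : rnorm (- x) = rnorm x.
Proof. by rewrite /rnorm normrN. Qed.

Lemma rnorm_distC E (x y : E) : rnorm (x - y) = rnorm (y - x).
Proof. by rewrite /rnorm distrC. Qed.

Lemma rnorm_distD E (z x y : E) :
  rnorm (x - y) <= rnorm (x - z) + rnorm (z - y).
Proof. by rewrite -(subrKA z x (- y)) rnormD. Qed.

Lemma rnorm0 E : rnorm (0 : E) = 0.
Proof. by rewrite /rnorm normr0 /toR; case: k. Qed.

Lemma rnormZ E (a : K) (x : E) : rnorm (a *: x) = rnorm (a : K^o) * rnorm x.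
Proof.
rewrite -[LHS]toRK -norm_ofR normrZ (norm_ofR x) (norm_ofR (a : K^o)).
by rewrite -ofRM toRK.
Qed.

Lemma rnorm_ofR r : 0 <= r -> rnorm (ofR r : K^o) = r.
Proof.
move=> r0; rewrite /rnorm ger0_norm ?toRK//.
by move: r0; rewrite -ler_ofR /ofR; case: k.
Qed.

Lemma rnorm_le1 E (x : E) : (`|x| <= 1) = (rnorm x <= 1).
Proof. by rewrite norm_ofR -ofR1 ler_ofR. Qed.

Lemma nbhs_rnormP E (x : E) (A : set E) :
  nbhs x A <-> exists2 e, 0 < e & forall y, rnorm (y - x) < e -> A y.
Proof.
split=> [/nbhs_normP[e /= e0 H]|[e e0 H]].
  exists (toR e); first by rewrite -ofR_gt0 -gt0_ofR.
  move=> y xy; apply: H; rewrite /= norm_ofR rnorm_distC.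
  by rewrite (gt0_ofR e0) ltr_ofR.
apply/nbhs_normP; exists (ofR e); first by rewrite /= ofR_gt0.
by move=> y; rewrite /= norm_ofR ltr_ofR rnorm_distC; exact: H.
Qed.

End ScalarNorm.

(** * The dual ball *)

Section DualBall.
Variables (R : realType) (k : scalar_kind).
Local Notation K := (scalar_field R k).
Implicit Types E F : normedModType K.

Lemma opnorm_leP E F (u : E -> F) (c : R) :
  (opnorm u <= c%:E)%E <-> forall x, rnorm x <= 1 -> rnorm (u x) <= c.
Proof.
split=> [uc x x1|uc].
  rewrite -lee_fin; apply: le_trans uc; apply: ereal_sup_ubound.
  by exists x => //; rewrite /unit_ball /= rnorm_le1.
apply: ge_ereal_sup => _ [x + <-]; rewrite /unit_ball /= rnorm_le1 => x1.
by rewrite lee_fin; exact: uc.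
Qed.

Lemma dual_ballP E (f : dual E) :
  dual_ball f <-> forall x, rnorm (f x) <= rnorm x.
Proof.
rewrite /dual_ball /= opnorm_leP; split=> fx x; last exact/le_trans/fx.
have [x0|x0] := eqVneq (rnorm x) 0.
  have : x = 0 by apply/normr0_eq0; rewrite norm_ofR x0 /ofR; case: (k).
  by move=> ->; rewrite linear0 !rnorm0.
have xp : 0 < rnorm x by rewrite lt_neqAle eq_sym x0 rnorm_ge0.
have vp : 0 <= (rnorm x)^-1 by rewrite invr_ge0 ltW.
have := fx (ofR k (rnorm x)^-1 *: x).
rewrite linearZ /= !rnormZ rnorm_ofR// mulVf// => /(_ (lexx _)).
by rewrite ler_pdivrMl// mulr1.
Qed.

(** Serves to build both Hahn-Banach functionals and weak-star limits as elements of the dual. *)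
Lemma dual_of_linear E (g : E -> K^o) :
  linear g -> (forall x, rnorm (g x) <= rnorm x) ->
  exists2 f : dual E, dual_ball f & forall x, f x = g x.
Proof.
move=> lg gx.
pose gL : {linear E -> K^o} :=
  HB.pack g (GRing.isLinear.Build K E K^o *:%R g lg).
have gb : bounded_near gL (nbhs (0 : E)).
  apply/linear_boundedP; near=> r => x.
  rewrite /= !norm_ofR; apply: le_trans (_ : ofR k (rnorm x) <= _).
    by rewrite ler_ofR gx.
  rewrite -norm_ofR ler_peMl//; near: r; apply: nbhs_pinfty_ge.
by exists (Operator gb); first exact/dual_ballP.
Unshelve. all: by end_near. Qed.

End DualBall.

(** * Norming functionals over the real and complex scalars *)

Lemma norming_real (R : realType)
  (E : normedModType (scalar_field R RealScalars)) (x : E) :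
  exists2 f : dual E, dual_ball f & rnorm x <= rnorm (f x).
Proof.
have sn : sublinear (@rnorm R RealScalars E).
  split=> [u v|t u t0]; first exact: rnormD.
  by rewrite rnormZ (@rnorm_ofR R RealScalars).
have [f fn fx] := hahn_banach_sublinear x sn.
have [|g gB gf] := @dual_of_linear R RealScalars E f (linearP f).
  (* Domination by the norm at [u] and at [- u] bounds the absolute value. *)
  move=> u; rewrite /rnorm /= ler_norml; apply/andP; split; last exact: fn.
  by rewrite lerNl -linearN -normrN; exact: fn.
by exists g => //; rewrite gf -fx {1}/rnorm /= ler_norm.
Qed.

(* Restriction of scalars to [R]; an alias, since [E] already carries a module
   structure over [R[i]]. *)
Definition realified (R : realType) (E : lmodType R[i]) : Type := E.

Section Realified.
Local Open Scope complex_scope.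
Variables (R : realType) (E : lmodType R[i]).

HB.instance Definition _ := GRing.Zmodule.on (realified E).

Definition realified_scale (r : R) (x : realified E) : realified E :=
  (r%:C *: (x : E))%R.

Fact realified_scaleA a b v :
  realified_scale a (realified_scale b v) = realified_scale (a * b) v.
Proof. by rewrite /realified_scale scalerA rmorphM. Qed.

Fact realified_scale1 : left_id 1 realified_scale.
Proof. by move=> v; rewrite /realified_scale scale1r. Qed.

Fact realified_scaleDr : right_distributive realified_scale +%R.
Proof. by move=> a u v; rewrite /realified_scale scalerDr. Qed.

Fact realified_scaleDl v : {morph realified_scale^~ v : a b / a + b}.
Proof. by move=> a b; rewrite /realified_scale rmorphD scalerDl. Qed.

HB.instance Definition _ := GRing.Zmodule_isLmodule.Build R (realified E)
  realified_scaleA realified_scale1 realified_scaleDr realified_scaleDl.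

End Realified.

Lemma rnorm_complex (R : realType) (a b : R) :
  rnorm ((a +i* b)%C : (scalar_field R ComplexScalars)^o) =
  Num.sqrt (a ^+ 2 + b ^+ 2).
Proof. exact: (congr1 (@complex.Re R) (normc_def (a +i* b)%C)). Qed.

(** A real functional [f] dominated by the norm is the real part of the complex-linear
    [g u = f u - i f (i u)], and a rotation of [u] shows that [g] is dominated too. *)
Lemma norming_complex (R : realType)
  (E : normedModType (scalar_field R ComplexScalars)) (x : E) :
  exists2 f : dual E, dual_ball f & rnorm x <= rnorm (f x).
Proof.
have sn : @sublinear R (realified E) (@rnorm R ComplexScalars E).
  split=> [u v|t u t0]; first exact: rnormD.
  by rewrite rnormZ (@rnorm_ofR R ComplexScalars).
have [f fn fx] := @hahn_banach_sublinear R (realified E) _ x sn.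
have fD (u v : E) : f (u + v) = f u + f v by exact: (linearD f).
have fZ (r : R) (u : E) : f (r%:C%C *: u) = r * f u by exact: (linearZ_LR f).
move: (f : E -> R) fn fx fD fZ => {sn} {}f fn fx fD fZ.
pose g (u : E) : R[i]%C := (f u +i* - f ('i%C *: u))%C.
have fZi (a : R[i]%C) (u : E) :
    f (a *: u) = complex.Re a * f u + complex.Im a * f ('i%C *: u).
  by rewrite {1}[a]complexE scalerDl fD mulrC -scalerA !fZ.
have fiD (u v : E) : f ('i%C *: (u + v)) = f ('i%C *: u) + f ('i%C *: v).
  by rewrite scalerDr fD.
have fiZ (a : R[i]%C) (u : E) : f ('i%C *: (a *: u)) =
    complex.Re a * f ('i%C *: u) - complex.Im a * f u.
  by rewrite scalerA fZi; case: a => a b /=; lra.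
have lg : linear (g : E -> (scalar_field R ComplexScalars)^o).
  move=> a u v; rewrite [LHS]/g fD fiD fZi fiZ.
  case: a => a b; apply/eqP; rewrite eq_complex /=; apply/andP.
  split; apply/eqP; lra.
pose n u := Num.sqrt (f u ^+ 2 + f ('i%C *: u) ^+ 2).
have gE u : rnorm (g u : (scalar_field R ComplexScalars)^o) = n u.
  by rewrite /n -(sqrrN (f ('i%C *: u))); exact: rnorm_complex.
have gn u : rnorm (g u : (scalar_field R ComplexScalars)^o) <= rnorm u.
  rewrite gE; have : 0 <= n u by exact: sqrtr_ge0.
  rewrite le_eqVlt => /predU1P[<-|n0]; first by rewrite rnorm_ge0.
  rewrite -(ler_pM2l n0).
  (* The scalar is the conjugate of [g u], of modulus [n u]; domination of [f] at this multiple of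
     [u] gives [n u * n u <= n u * rnorm u]. *)
  have -> : n u * n u = f ((f u +i* f ('i%C *: u))%C *: u).
    by rewrite fZi /= -!expr2 sqr_sqrtr// addr_ge0 ?sqr_ge0.
  apply: le_trans (fn _) _; rewrite rnormZ.
  apply: ler_wpM2r; first exact: rnorm_ge0.
  by rewrite le_eqVlt; apply/orP; left; apply/eqP; exact: rnorm_complex.
have [h hB hg] := dual_of_linear lg gn.
exists h => //; rewrite hg gE -fx.
apply: le_trans (ler_norm _) _; rewrite -sqrtr_sqr ler_wsqrtr//.
by rewrite lerDl sqr_ge0.
Qed.

Lemma norming_functional (R : realType) (k : scalar_kind)
  (E : normedModType (scalar_field R k)) (x : E) :
  exists2 f : dual E, dual_ball f & rnorm x <= rnorm (f x).
Proof.
by case: k E x => E x; [exact: norming_real | exact: norming_complex].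
Qed.

(** * Ultrafilters and compact balls of scalars *)

Lemma ultra_fmap (S T : Type) (f : S -> T) (U : set_system S) :
  UltraFilter U -> UltraFilter (f @ U).
Proof.
move=> UU; split=> [|G GF UG]; first exact: fmap_proper_filter.
apply/seteqP; split=> [A GA|]; last exact: UG.
(* Otherwise the finer filter [G] would contain both [A] and its complement. *)
have [//|UnA] := in_ultra_setVsetC (f @^-1` A) UU.
have GnA : G (~` A) by exact: UG.
by have /filter_ex[? []] : G (A `&` ~` A) by exact: filterI.
Qed.

Lemma real_ball_compact (R : realType) (M : R) :
  compact [set z : (scalar_field R RealScalars)^o | rnorm z <= M].
Proof.
have -> : [set z : (scalar_field R RealScalars)^o | rnorm z <= M] =
    `[- M, M]%classic :> set R.
  by apply/seteqP; split=> z; rewrite /= in_itv /= /rnorm /= ler_norml.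
exact: segment_compact.
Qed.

(** Along an ultrafilter the real and imaginary parts converge in a compact segment, and their
    limits assemble into a limit in the ball. *)
Lemma complex_ball_compact (R : realType) (M : R) :
  compact [set z : (scalar_field R ComplexScalars)^o | rnorm z <= M].
Proof.
have rnormE (z : R[i]%C) : rnorm (z : (scalar_field R ComplexScalars)^o) =
    Num.sqrt (complex.Re z ^+ 2 + complex.Im z ^+ 2).
  by case: z => a b; exact: rnorm_complex.
have part_cvg (U : set_system R[i]%C) (h : R[i]%C -> R) : UltraFilter U ->
    U [set z | `|h z| <= M] -> exists r : R, h @ U --> r.
  move=> UU UM.
  have UhU : UltraFilter (h @ U) by exact: ultra_fmap.
  have : compact `[- M, M]%classic by exact: segment_compact.
  rewrite compact_ultra => /(_ (h @ U) UhU)[].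
    suff : U (h @^-1` `[- M, M]) by [].
    by apply: filterS UM => z /=; rewrite in_itv /= ler_norml.
  by move=> r [_ hr]; exists r.
rewrite compact_ultra => U UU UM.
have leRe (z : R[i]%C) :
    `|complex.Re z| <= rnorm (z : (scalar_field R ComplexScalars)^o).
  by rewrite rnormE -sqrtr_sqr ler_wsqrtr// lerDl sqr_ge0.
have leIm (z : R[i]%C) :
    `|complex.Im z| <= rnorm (z : (scalar_field R ComplexScalars)^o).
  by rewrite rnormE -sqrtr_sqr ler_wsqrtr// lerDr sqr_ge0.
have leReIm (z : R[i]%C) : rnorm (z : (scalar_field R ComplexScalars)^o)
    <= `|complex.Re z| + `|complex.Im z|.
  rewrite rnormE -[leRHS]ger0_norm ?addr_ge0// -sqrtr_sqr ler_wsqrtr//.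
  by rewrite sqrrD !real_normK ?num_real// addrAC lerDl mulrn_wge0.
have [|a Ua] := @part_cvg U (@complex.Re R) UU.
  by apply: filterS UM => z; apply: le_trans.
have [|b Ub] := @part_cvg U (@complex.Im R) UU.
  by apply: filterS UM => z; apply: le_trans.
pose l : (scalar_field R ComplexScalars)^o := (a +i* b)%C.
have Ul : U --> l.
  move=> A /nbhs_rnormP[e e0 eA].
  have e2 : 0 < e / 2 by rewrite divr_gt0.
  move/cvgrPdistC_lt/(_ _ e2) : Ua => Ua.
  move/cvgrPdistC_lt/(_ _ e2) : Ub => Ub.
  apply: filterS2 Ua Ub => z /= za zb; apply: eA.
  apply: le_lt_trans (leReIm _) _; case: z za zb => c d /= za zb; lra.
exists l; split=> //; apply/ler_addgt0Pr => e e0 /=.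
have Ue : U [set z | rnorm ((z : (scalar_field R ComplexScalars)^o) - l) < e].
  by apply: Ul; apply/nbhs_rnormP; exists e.
have [z [zM ze]] := filter_ex (filterI UM Ue).
apply: (@le_trans _ _ (rnorm z + rnorm (l - z))).
  by have := rnormD z (l - z); rewrite addrC subrK.
by apply: lerD => //; rewrite rnorm_distC ltW.
Qed.

Lemma scalar_ball_compact (R : realType) (k : scalar_kind) (M : R) :
  compact [set z : (scalar_field R k)^o | rnorm z <= M].
Proof.
by case: k; [exact: real_ball_compact | exact: complex_ball_compact].
Qed.

(** * The weak-star topology and the Banach-Alaoglu theorem *)

Section WeakStar.
Variables (R : realType) (k : scalar_kind).
Local Notation K := (scalar_field R k).
Implicit Types E F : normedModType K.

Lemma weak_star_eval_continuous E (x : E) :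
  continuous (fun f : weak_star E => (f : dual E) x : K^o).
Proof.
move=> f; apply: (@continuous_comp _ _ _ (@dual_eval K E : weak_star E -> _)
  (fun h : {ptws E -> K^o} => h x)).
  exact: initial_continuous.
exact: (@proj_continuous E (fun=> K^o)).
Qed.

Lemma weak_star_cvg E (U : set_system (weak_star E)) (g : dual E) : Filter U ->
  (forall x,
    (fun f : weak_star E => (f : dual E) x : K^o) @ U --> (g x : K^o)) ->
  U --> (g : weak_star E).
Proof.
move=> FU Ug.
have {}Ug : @dual_eval K E @ U --> dual_eval g.
  by apply/pointwise_cvgP => x; exact: Ug.
move=> A; rewrite nbhsE => -[B [[C oC <-] Cg] BA].
by apply: filterS BA _; apply: Ug; apply: open_nbhs_nbhs.
Qed.

Lemma adjoint_weak_star_continuous E F (T : operator E F) :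
  continuous (adjoint T : weak_star F -> weak_star E).
Proof.
move=> g; apply: weak_star_cvg => [|x].
  exact: (@fmap_filter _ _ _ _ (@nbhs_filter (weak_star F) g)).
exact: (@weak_star_eval_continuous F (T x) g).
Qed.

(** Along an ultrafilter on the ball, each evaluation at [x] converges in the compact scalar ball of
    radius [rnorm x]. The limits form a functional in the dual ball, linear by uniqueness of
    limits. *)
Theorem banach_alaoglu E : compact (@dual_ball R k E : set (weak_star E)).
Proof.
rewrite compact_ultra => U UU UB.
have ev x : exists l : K^o, rnorm l <= rnorm x /\
    (fun f : weak_star E => (f : dual E) x : K^o) @ U --> l.
  have := @scalar_ball_compact R k (rnorm x); rewrite compact_ultra.
  pose e (f : weak_star E) : K^o := (f : dual E) x.
  move=> /(_ _ (ultra_fmap e UU))[].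
    suff : U (e @^-1` [set z | rnorm z <= rnorm x]) by [].
    by apply: filterS UB => f /dual_ballP; exact.
  by move=> l [xl Ul]; exists l.
have [g gP] := choice ev.
have gl : linear g.
  move=> a x y.
  have [_ Ul] := gP (a *: x + y); have [_ Ux] := gP x; have [_ Uy] := gP y.
  apply: (cvg_unique _ Ul); first exact: norm_hausdorff.
  rewrite (_ : (fun f => _) =
    (fun f : weak_star E => (a *: ((f : dual E) x) + (f : dual E) y) : K^o)).
    exact: cvgD (cvgZ (cvg_cst a) Ux) Uy.
  by apply/funext => f; rewrite linearP.
have [f fB fg] := dual_of_linear gl (fun x => (gP x).1).
exists f; split=> //; apply: weak_star_cvg => x; rewrite fg.
exact: (gP x).2.
Qed.

End WeakStar.

(** * The first Szlenk derivation and compactness of the operator *)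

Lemma subr_telescope (V : zmodType) (a b c d : V) :
  a - b = (c - d) + ((a - c) - (b - d)).
Proof.
by rewrite opprB [RHS]addrC addrACA subrK (addrAC d) subrr add0r.
Qed.

Section CompactSzlenk.
Variables (R : realType) (k : scalar_kind).
Local Notation K := (scalar_field R k).

Lemma diam_leP (E : normedModType K) (A : set (dual E)) (c : R) :
  (diam A <= c%:E)%E <-> forall f g : dual E, A f -> A g ->
    forall x, rnorm x <= 1 -> rnorm (f x - g x) <= c.
Proof.
split=> [Ac f g Af Ag|Ac].
  apply/opnorm_leP; apply: le_trans Ac; apply: ereal_sup_ubound.
  by exists f => //; exists g.
by apply: ge_ereal_sup => _ [f Af [g Ag <-]]; apply/opnorm_leP; exact: Ac.
Qed.

Lemma rnorm_bounded (E F : normedModType K) (T : operator E F) :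
  exists M, forall x, rnorm x <= 1 -> rnorm (T x) <= M.
Proof.
have /linear_boundedP/pinfty_ex_gt0[r r0 Tr] := @op_bounded _ _ _ T.
exists (toR r) => x x1; rewrite -(ler_ofR k) -norm_ofR -gt0_ofR//.
by apply: le_trans (Tr x) _; rewrite -[leRHS]mulr1 ler_pM2l// rnorm_le1.
Qed.

(** Since [opow omega OZero] is one, the index must omit the ordinal one; it then omits every larger
    ordinal because derivations decrease. *)
Lemma SZ0P (E F : normedModType K) (T : operator E F) :
  SZ OZero T <-> forall eps : R, 0 < eps ->
    szlenk_step eps (adjoint T @` @dual_ball R k F) = set0.
Proof.
split=> [T0 eps eps0|T0 b [eps eps0 [f fb]]].
  apply/eqP/negPn/negP => /set0P ne.
  by apply: (T0 (OSucc OZero)); exists eps.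
have [//|b0] := ole_total b OZero.
by have := szlenk_deriv_decr b0 fb; rewrite /= T0.
Qed.

Section Operator.
Variables (E F : normedModType K) (T : operator E F).
Local Notation C := (closure (T @` @unit_ball K E)).

Lemma closure_ball_approx y (e : R) : C y -> 0 < e ->
  exists2 x, rnorm x <= 1 & rnorm (T x - y) < e.
Proof.
move=> Cy e0; have /Cy[_ [[x + <-] xe]] : nbhs y [set z | rnorm (z - y) < e].
  by apply/nbhs_rnormP; exists e.
by rewrite /unit_ball /= rnorm_le1 => x1; exists x.
Qed.

(** Both functionals are 1-Lipschitz, hence the factor two. *)
Lemma dual_ball_dist (g h : dual F) (y z : F) : dual_ball g -> dual_ball h ->
  rnorm (g y - h y) <= rnorm (g z - h z) + rnorm (y - z) *+ 2.
Proof.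
move=> /dual_ballP gB /dual_ballP hB.
have -> : g y - h y = (g z - h z) + (g (y - z) - h (y - z)) :> K^o.
  by rewrite (linearB g) (linearB h); exact: subr_telescope.
apply: le_trans (rnormD _ _) _; apply: lerD => //.
apply: le_trans (rnormD _ _) _; rewrite rnormN mulr2n.
by apply: lerD; [exact: gB|exact: hB].
Qed.

Lemma closure_ball_dist (g h : dual F) (c : R) : dual_ball g -> dual_ball h ->
  (forall x, rnorm x <= 1 -> rnorm (g (T x) - h (T x)) <= c) ->
  forall y, C y -> rnorm (g y - h y) <= c.
Proof.
move=> gB hB ghc y Cy; apply/ler_addgt0Pr => e e0.
have [x x1 xy] := closure_ball_approx Cy (divr_gt0 e0 (ltr0Sn _ 1)).
apply: le_trans (dual_ball_dist y (T x) gB hB) _.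
have := ghc x x1; rewrite (rnorm_distC y); move: xy; lra.
Qed.

(* Near [f = adjoint T g0] in the weak-star topology, the functionals
   [adjoint T g] with [g] in the dual ball are uniformly close to [f], because
   the compact set [C] turns pointwise closeness into uniform closeness. *)
Lemma compact_szlenk (eps : R) : 0 < eps -> compact_operator T ->
  szlenk_step eps (adjoint T @` @dual_ball R k F) = set0.
Proof.
move=> eps0; rewrite /compact_operator precompactE => cC.
apply/eqP/negPn/negP => /set0P[_ [[g0 g0B <-] fV]].
(* A functional [h] on [E] has no value at a point of [F], so all its preimages in the dual ball are
   considered. *)
pose P (h : weak_star E) (y : F) := forall g, dual_ball g -> adjoint T g = h ->
  rnorm (g y - g0 y) <= eps / 2.
(* The error below is one [d] from [h] at [x] and twice [2 d] from the distance of [y'] to [T x], in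
   all [eps / 2]. *)
pose d := eps / 10.
have d0 : 0 < d by rewrite divr_gt0.
have near_P : \forall h \near (adjoint T g0 : weak_star E), C `<=` P h.
  have := (compact_near_coveringP _).1 cC.
  move=> /(_ _ (nbhs (adjoint T g0 : weak_star E)) P); apply => y Cy.
  have [x x1 xy] := closure_ball_approx Cy d0.
  have near_y : nbhs y [set y' | rnorm (y' - y) < d].
    by apply/nbhs_rnormP; exists d.
  have near_h : \forall h \near (adjoint T g0 : weak_star E),
      rnorm ((h : dual E) x - adjoint T g0 x) < d.
    apply: (@weak_star_eval_continuous R k E x (adjoint T g0)
      [set z | rnorm (z - adjoint T g0 x) < d]).
    by apply/nbhs_rnormP; exists d.
  exists ([set y' | rnorm (y' - y) < d],
    [set h : weak_star E | rnorm ((h : dual E) x - adjoint T g0 x) < d]) => //.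
  move=> [y' h] [/= y'd hd] g gB gh.
  apply: le_trans (dual_ball_dist y' (T x) gB g0B) _.
  have : rnorm (g (T x) - g0 (T x)) < d by move: hd; rewrite -gh.
  have := rnorm_distD y y' (T x).
  rewrite (rnorm_distC y) /d in d0 xy y'd *; lra.
(* On this weak-star open set any two functionals lie within [eps / 2] of [g0] on the image of the
   unit ball, so the diameter is at most [eps]. *)
have := fV _ (open_interior _) near_P; rewrite ltNge => /negP; apply.
apply/diam_leP => _ _ [[g gB <-] /interior_subset gP]
  [[h hB <-] /interior_subset hP] x x1.
have CTx : C (T x).
  by apply: subset_closure; exists x => //; rewrite /unit_ball /= rnorm_le1.
have := gP _ CTx g gB erefl; have := hP _ CTx h hB erefl.
rewrite rnorm_distC => hx gx.
have := rnorm_distD (g0 (T x)) (g (T x)) (h (T x)); rewrite /=; lra.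
Qed.

(* An ultrafilter on [C] converges along each single functional; weak-star
   compactness of the dual ball, with [(U, U)] as parameter filter, makes this
   uniform over the ball, and norming functionals then bound the norm. *)
Lemma szlenk_cauchy (U : set_system F) : UltraFilter U -> U C ->
  (forall eps : R, 0 < eps ->
    szlenk_step eps (adjoint T @` @dual_ball R k F) = set0) ->
  cauchy U.
Proof.
move=> UU UC T0; apply/cauchy_ballP => e' e'0.
(* The uniform bound obtained below is [3 d], which must be strictly less than [e]. *)
pose e := toR e'; pose d := e / 4.
have e0 : 0 < e by rewrite -(ofR_gt0 k) -gt0_ofR.
have d0 : 0 < d by rewrite divr_gt0.
have d2 : 0 < d / 2 by rewrite divr_gt0.
have [M TM] := rnorm_bounded T.
have limU (g : dual F) : dual_ball g ->
    exists l : K, U [set y | rnorm (g y - l : K^o) < d / 2].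
  move=> gB.
  (* Points of the closure lie within [1] of the image of the unit ball, which has norm bound
     [M]. *)
  have := @scalar_ball_compact R k (M + 1); rewrite compact_ultra.
  move=> /(_ _ (ultra_fmap (g : F -> K^o) UU))[].
    suff : U [set y | rnorm (g y) <= M + 1] by [].
    apply: filterS UC => y Cy /=.
    have [x x1 xy] := closure_ball_approx Cy ltr01.
    move/dual_ballP : gB => /(_ y) gy; apply: le_trans gy _.
    have := rnormD (T x) (y - T x); rewrite addrC subrK rnorm_distC.
    have := TM x x1; lra.
  move=> l [_ Ul]; exists l.
  suff : U (g @^-1` [set z : K^o | rnorm (z - l) < d / 2]) by [].
  by apply: Ul; apply/nbhs_rnormP; exists (d / 2).
pose A := adjoint T @` @dual_ball R k F.
pose P (yz : F * F) (g : weak_star F) :=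
  rnorm ((g : dual F) yz.1 - (g : dual F) yz.2) <= d *+ 3.
have near_P : \forall yz \near (U, U), @dual_ball R k F `<=` P yz.
  have : near_covering_within (@dual_ball R k F : set (weak_star F)).
    apply/near_covering_withinP/compact_near_coveringP.
    exact: banach_alaoglu.
  move=> /(_ _ (filter_prod U U) P); apply => g0 g0B.
  (* Were there no such slice, [adjoint T g0] would survive the derivation. *)
  have [V [oV Vg AV]] : exists V : set (weak_star E),
      [/\ open V, V (adjoint T g0) & (diam (A `&` V) <= d%:E)%E].
    apply: contrapT => noV.
    suff : szlenk_step d A (adjoint T g0) by rewrite T0.
    split=> [|V oV Vg]; first by exists g0.
    by rewrite ltNge; apply/negP => AV; apply: noV; exists V.
  have near_g : nbhs (g0 : weak_star F) [set g | V (adjoint T g)].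
    apply: (@adjoint_weak_star_continuous R k E F T g0).
    exact: open_nbhs_nbhs.
  have [l Ul] := limU g0 g0B.
  pose S := C `&` [set y | rnorm (g0 y - l : K^o) < d / 2].
  have US : U S by exact: filterI.
  exists ([set g | V (adjoint T g)], S `*` S).
    by split=> //=; exists (S, S).
  move=> [g [y z]] [/= Vg' [[Cy yl] [Cz zl]]] gB; rewrite /P /=.
  have gg0 u : C u -> rnorm (g u - g0 u) <= d.
    apply: closure_ball_dist => // x x1.
    have := (diam_leP _ _).1 AV (adjoint T g) (adjoint T g0); apply => //.
      by split=> //; exists g.
    by split=> //; exists g0.
  (* The path from [g y] to [g z] runs through [g0 y], [l] and [g0 z], at cost [d], [d / 2], [d / 2]
     and [d]. *)
  have := gg0 y Cy; have := gg0 z Cz; rewrite (rnorm_distC (g z)).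
  have := rnorm_distD (g0 y) (g y) (g z).
  have := rnorm_distD (g0 z) (g0 y) (g z).
  have := @rnorm_distD R k K^o l (g0 y) (g0 z).
  move: yl zl; rewrite /= (@rnorm_distC R k K^o l); lra.
apply: filterS near_P => -[y z] /= yzP.
rewrite -ball_normE /= norm_ofR (gt0_ofR e'0) ltr_ofR -/e.
have [f fB] := norming_functional (y - z); rewrite linearB => yzf.
have := yzP f fB; rewrite /P /=; move: yzf; rewrite /d; lra.
Qed.

End Operator.

(** Completeness of [F] turns the Cauchy ultrafilter into a convergent one, and the limit stays in
    the closure. *)
Lemma szlenk_compact (E : normedModType K) (F : completeNormedModType K)
  (T : operator E F) :
  (forall eps : R, 0 < eps ->
    szlenk_step eps (adjoint T @` @dual_ball R k F) = set0) ->
  compact_operator T.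
Proof.
move=> T0; rewrite /compact_operator precompactE compact_ultra => U UU UC.
have /cauchy_cvg Ul := szlenk_cauchy UU UC T0.
exists (lim U); split=> //; apply: closed_closure => B /Ul UB.
exact: filter_ex (filterI UC UB).
Qed.

End CompactSzlenk.

Theorem proposition2p3 (R : realType) (k : scalar_kind)
  (E F : completeNormedModType (scalar_field R k)) (T : operator E F) :
  SZ OZero T <-> compact_operator T.
Proof.
rewrite SZ0P; split; last by move=> cT eps eps0; exact: compact_szlenk.
exact: szlenk_compact.
Qed.
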